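(* Let $N\ge 2$, let $\alpha\in[0,\infty)$ and let $m=\lfloor N^{\alpha}\rfloor$. Consider the quantum walk on the graph $K_N\wedge_{v^*}S_m$ with time evolution operator $U$, initial state $\psi_0$ and success probability $p_t(v^* )$ as described in the context. Then for sufficiently large $N$, the optimal running time $t_{\mathrm{opt}}$ (the time at which $p_t(v^* )$ is maximized) satisfies $$t_{\mathrm{opt}}=\begin{cases} O\big(N^{\frac{2-\alpha}{2}}\big) & 0\le\alpha\le 1,\\ O(\sqrt{N}) & 1<\alpha.\end{cases}$$
   Context: $K_N$ is the complete graph on $N$ vertices and $S_m$ is the star graph (a tree with one center vertex and $m$ leaves). The graph $K_N\wedge_{v^*}S_m$ is obtained from the disjoint union of $K_N$ and $S_m$ by identifying one fixed vertex of $K_N$ with the center of $S_m$; the identified vertex is denoted $v^*$ (so $\deg(v^* )=N-1+m$). Let $V_S$ denote the set of the $m$ leaves of the star. Let $A$ be the set of symmetric arcs (each edge gives two opposite arcs); for an arc $a$, $o(a)$ and $t(a)$ are its origin and terminus, $\bar a$ is its inverse arc, and $\deg(v)=|\{a\in A: t(a)=v\}|$. The time evolution operator $U$ on $\mathbb{C}^A$ is $U=S(2d^*d-I)$, where $(S\psi)(a)=\psi(\bar a)$ and $d:\mathbb{C}^A\to\mathbb{C}^V$ is given by $(d\psi)(v)=\deg(v)^{-1/2}\sum_{a:t(a)=v}\psi(a)$ for $v\notin V_S$ and $(d\psi)(v)=0$ for $v\in V_S$. Explicitly, for $\psi\in\mathbb{C}^A$ and $a\in A$: $(U\psi)(a)=-\psi(\bar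 a)+\frac{2}{\deg(t(a))}\sum_{b\in A:\,o(b)=t(a)}\psi(b)$ if $t(a)\notin V_S$, and $(U\psi)(a)=-\psi(\bar a)$ if $t(a)\in V_S$ (phase reversal at the leaves). The initial state is $\psi_0(a)=1/\sqrt{N(N-1)}$ for $a\in A(K_N)$ and $\psi_0(a)=0$ otherwise, and $\psi_t=U^t\psi_0$. The probability of finding vertex $v$ at time $t$ is $p_t(v)=\sum_{a\in A:\,t(a)=v}|\psi_t(a)|^2$. The optimal running time $t_{\mathrm{opt}}$ is the time step at which the success probability $p_t(v^* )$ is maximized.
   Formalization: Since p_t(v* ) is almost periodic and in general has no maximizer over all times, t_opt is taken to be the first peak: the least t with p_t(v* ) > p_0(v* ) and p_t(v* ) ≥ p_s(v* ) for all 0 ≤ s ≤ 2t. *)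

(* Defs.v *)
From HB Require Import structures.
From mathcomp Require Import all_boot all_order all_algebra.
From mathcomp Require Import reals exp.
Set Implicit Arguments. Unset Strict Implicit. Unset Printing Implicit Defensive.
Import Order.TTheory GRing.Theory Num.Theory.
Local Open Scope ring_scope.

(* The graph  K_N  /\_{v*}  S_m.
   Vertices are the natural numbers 0 .. N+m-1:
     0 .. N-1     : the vertices of K_N, vertex 0 is v* (center of the star);
     N .. N+m-1   : the m leaves of the star (the set V_S).                   *)

Definition is_leaf (N : nat) (v : nat) : bool := (N <= v)%N.

Definition adj (N m : nat) (u w : nat) : bool :=
  [&& (u < N)%N, (w < N)%N & u != w]
  || [&& u == 0%N, (N <= w)%N & (w < N + m)%N]
  || [&& (N <= u)%N, (u < N + m)%N & w == 0%N].

Definition deg (N m : nat) (v : nat) : nat := (\sum_(u < N + m | adj N m u v) 1)%N.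

(* A state psi in C^A is represented as a function on ordered pairs of
   vertices, psi u w being the amplitude of the arc u -> w (its value on
   non-arcs is irrelevant; U and psi_0 make it 0 there).  Amplitudes are real:
   U is a real operator and psi_0 is real, so psi_t is real and
   |psi_t(a)|^2 = psi_t(a)^2. *)
Definition state (R : realType) := nat -> nat -> R.

(* time evolution operator U = S(2 d^* d - I), written out explicitly *)
Definition Uop (R : realType) (N m : nat) (psi : state R) : state R :=
  fun u v =>
    if adj N m u v then
      if is_leaf N v then - psi v u
      else - psi v u + 2 / (deg N m v)%:R * \sum_(w < N + m | adj N m v w) psi v w
    else 0.

Definition psi0 (R : realType) (N : nat) : state R :=
  fun u w => if [&& (u < N)%N, (w < N)%N & u != w]
             then (Num.sqrt ((N * (N - 1))%:R))^-1 else 0.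

Definition psi (R : realType) (N m t : nat) : state R := iter t (Uop N m) (psi0 R N).

Definition prob (R : realType) (N m t v : nat) : R :=
  \sum_(u < N + m | adj N m u v) (psi R N m t u v) ^+ 2.

Definition psucc (R : realType) (N m t : nat) : R := prob R N m t 0.

(* Optimal running time = time of the first peak of p_t(vstar):
   t is a peak if p_t(vstar) exceeds the initial value p_0(vstar) and p_t(vstar) is the
   maximum of p_s(vstar) over the window 0 <= s <= 2t (a window centred at t);
   t_opt is the first (least) such t. *)
Definition is_peak (R : realType) (N m t : nat) : Prop :=
  psucc R N m 0 < psucc R N m t /\
  forall s : nat, (s <= 2 * t)%N -> psucc R N m s <= psucc R N m t.

Definition is_topt (R : realType) (N m t : nat) : Prop :=
  is_peak R N m t /\ forall s : nat, (s < t)%N -> ~ is_peak R N m s.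

Definition mstar (R : realType) (N : nat) (alpha : R) : nat :=
  Num.truncn (powR (N%:R) alpha).

Definition topt_bound (R : realType) (alpha : R) (N : nat) : R :=
  if alpha <= 1 then powR (N%:R) ((2 - alpha) / 2) else Num.sqrt (N%:R).

(* Main.v *)
(* The walk preserves the states that are constant on the five kinds of arcs, so
   it reduces to a 5-dimensional isometry. Write n = N - 1. The random walk on
   K_N killed when it leaves for a leaf has a top eigenvalue mu = cos th with
   m / (N (n + m)) <= 1 - mu <= 1 / n, and the pull-backs of its eigenfunction
   along terminus and origin span a plane on which U acts as a rotation by th.
   The initial state is O(1/sqrt N)-close to this plane, hence
   the success probability is K sin^2(t th) + O(1/sqrt N) uniformly in t, with
   K close to 1/2.
   On 0 <= t <= L with L th close to 4 pi / 3, the values for t > L/2 are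
   at most 3K/4 + o(1), while K - o(1) is reached near t th = pi / 2; so the
   maximum over [0, L] is attained at some t <= L/2, and this t is a peak of size
   O(1/th). *)
Require Import Defs.
From HB Require Import structures.
From mathcomp Require Import all_boot all_order all_algebra.
From mathcomp Require Import reals exp.
From mathcomp Require Import boolp topology normedtype derive trigo.
From mathcomp Require Import zify ring lra.
Import Order.TTheory GRing.Theory Num.Theory.
Import numFieldNormedType.Exports.
Local Open Scope ring_scope.

(** * Neighbourhood sums and degrees *)

Lemma adj_sym (N m u w : nat) : adj N m u w = adj N m w u.
Proof. by rewrite /adj; apply/idP/idP; lia. Qed.

Lemma sum_nat_constant (R : realType) (i j : nat) (P : pred nat) (F : nat -> R)
    (c : R) :
  (forall w, (i <= w < j)%N -> P w) -> (forall w, (i <= w < j)%N -> F w = c) ->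
  \sum_(i <= w < j | P w) F w = (j - i)%:R * c.
Proof.
move=> Pij Fij; rewrite (@congr_big_nat _ _ _ i j i j P xpredT F (fun=> c))//.
- by rewrite sumr_const_nat mulr_natl.
- by move=> w /andP[_ /Fij].
Qed.

Lemma sum_nat_empty (R : realType) (i j : nat) (P : pred nat) (F : nat -> R) :
  (forall w, (i <= w < j)%N -> ~~ P w) -> \sum_(i <= w < j | P w) F w = 0.
Proof.
by move=> Pij; rewrite big_nat_cond big1 // => w /andP[/Pij /negbTE->].
Qed.

Lemma sum_nbr_center (R : realType) (n m : nat) (F : nat -> R) (z p : R) :
  (forall w : nat, (0 < w <= n)%N -> F w = z) ->
  (forall w : nat, (n < w < n.+1 + m)%N -> F w = p) ->
  \sum_(w < n.+1 + m | adj n.+1 m 0 w) F w = n%:R * z + m%:R * p.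
Proof.
move=> Fz Fp; rewrite -(big_mkord (adj n.+1 m 0)).
rewrite (big_cat_nat _ (n := n.+1)) ?leq_addr//; congr (_ + _).
- rewrite big_ltn_cond // (_ : adj _ _ _ _ = false); last by rewrite /adj; lia.
  rewrite (sum_nat_constant _ _ _ _ _ z) ?subn1//= => w w_n.
  by rewrite /adj; lia.
- rewrite (sum_nat_constant _ _ _ _ _ p) ?addKn // => w w_n.
  by rewrite /adj; lia.
Qed.

Lemma sum_nbr_noncenter (R : realType) (n m v : nat) (F : nat -> R) (x y : R) :
  (0 < v <= n)%N -> F 0%N = y ->
  (forall w : nat, (0 < w <= n)%N -> w != v -> F w = x) ->
  \sum_(w < n.+1 + m | adj n.+1 m v w) F w = (n%:R - 1) * x + y.
Proof.
move=> v_n Fy Fx; rewrite -(big_mkord (adj n.+1 m v)).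
rewrite (big_cat_nat _ (n := n.+1)) ?leq_addr//.
rewrite (sum_nat_empty _ n.+1) ?addr0; last by move=> w; rewrite /adj; lia.
rewrite big_ltn_cond // (_ : adj _ _ _ _ = true) ?Fy; last by rewrite /adj; lia.
rewrite /= addr0 [RHS]addrC; congr (_ + _).
(* No vertex is adjacent to itself, so the sum is split around [v]: the [v - 1] terms below and the
   [n - v] terms above make [n - 1] in all. *)
rewrite (big_cat_nat _ (n := v)); [|lia..].
rewrite (@big_ltn_cond _ _ _ v); last lia.
rewrite (_ : adj _ _ _ _ = false); last by rewrite /adj; lia.
rewrite (sum_nat_constant _ 1 v _ _ x);
  [|by rewrite /adj; lia|by move=> w ?; apply: Fx; lia].
rewrite (sum_nat_constant _ v.+1 n.+1 _ _ x);
  [|by rewrite /adj; lia|by move=> w ?; apply: Fx; lia].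
rewrite /= -mulrDl -natrD; congr (_ * _).
by rewrite -[1]/1%:R -natrB; [congr (_%:R)|]; lia.
Qed.

Lemma degE (R : realType) (N m v : nat) :
  (deg N m v)%:R = \sum_(w < N + m | adj N m v w) 1 :> R.
Proof.
by rewrite /deg natr_sum; apply: eq_bigl => w; rewrite adj_sym.
Qed.

Lemma deg_center (R : realType) (n m : nat) :
  (deg n.+1 m 0)%:R = n%:R + m%:R :> R.
Proof. by rewrite degE (sum_nbr_center _ _ _ (fun=> 1) 1 1)// !mulr1. Qed.

Lemma deg_noncenter (R : realType) (n m v : nat) : (0 < v <= n)%N ->
  (deg n.+1 m v)%:R = n%:R :> R.
Proof.
by move=> v_n; rewrite degE (sum_nbr_noncenter _ _ _ _ (fun=> 1) 1 1)// mulr1 subrK.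
Qed.

(** * Reduction to five amplitudes *)

(* The amplitudes of a state invariant under the automorphisms of the graph:
   on the arcs of K_N off v*, from K_N to v*, from v* to K_N, from v* to a leaf
   and from a leaf to v*. *)
Record amps (R : realType) :=
  Amps { ax : R; ay : R; az : R; ap : R; aq : R }.
Arguments Amps {R}.
Arguments ax {R}. Arguments ay {R}. Arguments az {R}.
Arguments ap {R}. Arguments aq {R}.

Definition spread (R : realType) (N m : nat) (s : amps R) : state R :=
  fun u v =>
    if adj N m u v then
      if v == 0%N then if (u < N)%N then ay s else aq s
      else if u == 0%N then if (v < N)%N then az s else ap s
      else ax s
    else 0.
Arguments spread {R}.

(** [a] and [b] are twice the mean amplitude leaving a noncentral vertex of the clique and the
    centre, respectively; [- aq s] is the phase reversal at a leaf. *)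
Definition step (R : realType) (n m : R) (s : amps R) : amps R :=
  let a := 2 / n * ((n - 1) * ax s + ay s) in
  let b := 2 / (n + m) * (n * az s + m * ap s) in
  Amps (a - ax s) (b - az s) (a - ay s) (- aq s) (b - ap s).
Arguments step {R}.

(** The reflection at a vertex sees only its neighbourhood sum, which depends on the kinds of arcs
    alone. States are compared pointwise, so the iteration needs no extensionality. *)
Lemma Uop_spread (R : realType) (n m : nat) (s : amps R) (f : state R) :
  (forall u v, f u v = spread n.+1 m s u v) ->
  forall u v, Uop n.+1 m f u v = spread n.+1 m (step n%:R m%:R s) u v.
Proof.
move=> fE u v; rewrite /Uop /spread /is_leaf.
case: ifP => // uv; rewrite fE /spread adj_sym uv.
have [v0|v_gt0] := posnP v.
  subst v; rewrite ltn0 /= deg_center.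
  rewrite (sum_nbr_center _ _ _ (f 0%N) (az s) (ap s)).
  - move: uv; rewrite /adj => uv.
    have -> : (u == 0%N) = false by lia.
    by case: ifP => _; rewrite addrC.
  - move=> w w_n; rewrite fE /spread (_ : adj _ _ _ _ = true); last by rewrite /adj; lia.
    have -> : (w == 0)%N = false by lia.
    by have -> : (w < n.+1)%N by lia.
  - move=> w w_n; rewrite fE /spread (_ : adj _ _ _ _ = true); last by rewrite /adj; lia.
    have -> : (w == 0)%N = false by lia.
    by have -> : (w < n.+1)%N = false by lia.
have [v_leaf|v_n] := leqP n.+1 v.
  have u0 : u = 0%N by move: uv; rewrite /adj; lia.
  by subst u.
have vn : (0 < v <= n)%N by lia.
rewrite deg_noncenter// (sum_nbr_noncenter _ _ _ _ (f v) (ax s) (ay s))//.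
- by have [u0|u_gt0] := posnP u; rewrite ?u0 ?(gtn_eqF u_gt0) /= addrC.
- by rewrite fE /spread (_ : adj _ _ _ _ = true) ?v_n//; rewrite /adj; lia.
- move=> w w_n wv; rewrite fE /spread (_ : adj _ _ _ _ = true); last by rewrite /adj; lia.
  have -> : (w == 0)%N = false by lia.
  by have -> : (v == 0)%N = false by lia.
Qed.

Definition scale0 (R : realType) (c : R) : amps R := Amps c c c 0 0.

Lemma psi_spread (R : realType) (n m t : nat) u v :
  psi R n.+1 m t u v =
  spread n.+1 m (iter t (step n%:R m%:R)
    (scale0 R (Num.sqrt ((n.+1 * n)%:R))^-1)) u v.
Proof.
elim: t u v => [|t IH] u v; last exact: Uop_spread.
rewrite /psi /= /psi0 /spread /= subn1 /=.
set c := _^-1.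
by rewrite /adj; repeat (case: ifP => ?); try exact: erefl; exfalso; lia.
Qed.

Definition into_center (R : realType) (n m : R) (s : amps R) : R :=
  n * ay s ^+ 2 + m * aq s ^+ 2.

Lemma psuccE (R : realType) (n m t : nat) :
  psucc R n.+1 m t = into_center R n%:R m%:R (iter t (step n%:R m%:R)
    (scale0 R (Num.sqrt ((n.+1 * n)%:R))^-1)).
Proof.
rewrite /psucc /prob (eq_bigl (fun u : 'I__ => adj n.+1 m 0 u)) => [|u]; last exact: adj_sym.
apply: (sum_nbr_center _ _ _ (fun u => psi R n.+1 m t u 0 ^+ 2)) => w w_n.
  rewrite psi_spread /spread (_ : adj _ _ _ _ = true); last by rewrite /adj; lia.
  by have -> : (w < n.+1)%N by lia.
rewrite psi_spread /spread (_ : adj _ _ _ _ = true); last by rewrite /adj; lia.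
by rewrite (_ : (w < n.+1)%N = false)//; lia.
Qed.

(** * Norm conservation and linearity *)

Definition energy (R : realType) (n m : R) (s : amps R) : R :=
  n * (n - 1) * ax s ^+ 2 + n * ay s ^+ 2 + n * az s ^+ 2
  + m * ap s ^+ 2 + m * aq s ^+ 2.
Arguments energy {R}.

(** This is the unitarity of U: [energy] is the squared norm of the spread state, each square being
    weighted by the number of arcs of its kind. It controls the part of the initial state off the
    invariant plane uniformly in time. *)
Lemma energy_step (R : realType) (n m : R) (s : amps R) :
  n != 0 -> n + m != 0 -> energy n m (step n m s) = energy n m s.
Proof.
by move=> n0 nm0; case: s => x y z p q; rewrite /energy /step /=; field; rewrite n0 nm0.
Qed.

Lemma energy_iter_step (R : realType) (n m : R) (t : nat) (s : amps R) :
  n != 0 -> n + m != 0 -> energy n m (iter t (step n m) s) = energy n m s.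
Proof. by move=> n0 nm0; elim: t => //= t <-; exact: energy_step. Qed.

Lemma into_center_le_energy (R : realType) (n m : R) (s : amps R) :
  1 <= n -> 0 <= m -> into_center R n m s <= energy n m s.
Proof.
move=> n1 m0; rewrite /into_center /energy.
have := mulr_ge0 (mulr_ge0 (_ : 0 <= n) (_ : 0 <= n - 1)) (sqr_ge0 (ax s)).
have := mulr_ge0 (_ : 0 <= n) (sqr_ge0 (az s)).
have := mulr_ge0 m0 (sqr_ge0 (ap s)).
by move=> h1 /(_ ltac:(lra)) h2 /(_ ltac:(lra) ltac:(lra)) h3; lra.
Qed.

Definition lincomb (R : realType) (k l : R) (s s' : amps R) : amps R :=
  Amps (k * ax s + l * ax s') (k * ay s + l * ay s') (k * az s + l * az s')
       (k * ap s + l * ap s') (k * aq s + l * aq s').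
Arguments lincomb {R}.

Lemma step_lincomb (R : realType) (n m k l : R) (s s' : amps R) :
  step n m (lincomb k l s s') = lincomb k l (step n m s) (step n m s').
Proof. by rewrite /step /lincomb /=; congr Amps; ring. Qed.

Lemma iter_step_lincomb (R : realType) (n m k l : R) (t : nat) (s s' : amps R) :
  iter t (step n m) (lincomb k l s s') =
  lincomb k l (iter t (step n m) s) (iter t (step n m) s').
Proof. by elim: t => //= t ->; exact: step_lincomb. Qed.

(** * The killed random walk and its invariant plane *)

(* mu is the top eigenvalue of the random walk killed at the leaves, and the
   function equal to h at v*, 1 on the rest of K_N and 0 on the leaves
   is an eigenfunction. *)
Definition dirichlet_eigenpair (R : realType) (n m mu h : R) : Prop :=
  [/\ 1 / 2 <= mu < 1, 0 <= h <= 1, h = 1 - n * (1 - mu) & (n + m) * mu * h = n].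
Arguments dirichlet_eigenpair {R}.

(** Eliminating [h] leaves mu^2 - (1 - 1/n) mu - 1/(n + m) = 0, and [mu] is the larger root. It is
    below 1 because 1/(n + m) < 1/n. *)
Lemma dirichlet_eigenpair_exists (R : realType) (n m : R) :
  2 <= n -> 0 < m -> exists mu h, dirichlet_eigenpair n m mu h.
Proof.
move=> n2 m0; pose b := 1 - n^-1; pose s := Num.sqrt (b ^+ 2 + 4 / (n + m)).
have n0 : 0 < n by lra.
have D0 : 0 < n + m by lra.
have ni : n * n^-1 = 1 by rewrite mulfV// gt_eqF.
have Di : (n + m) * (n + m)^-1 = 1 by rewrite mulfV// gt_eqF.
have ni0 : 0 < n^-1 by rewrite invr_gt0.
have Di0 : 0 < (n + m)^-1 by rewrite invr_gt0.
have ni2 : n^-1 <= 1 / 2 by nra.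
have Dn : (n + m)^-1 < n^-1 by rewrite ltf_pV2 ?posrE//; lra.
have s2 : s ^+ 2 = b ^+ 2 + 4 / (n + m).
  by rewrite sqr_sqrtr// addr_ge0 ?sqr_ge0//; lra.
have s0 : 0 <= s by exact: sqrtr_ge0.
have bE : b = 1 - n^-1 by [].
have sb : b <= s by rewrite leNgt; apply/negP => sb; nra.
have sB : s < 2 - b by rewrite ltNge; apply/negP => sb'; nra.
clearbody s b.
have nb : n * b = n - 1 by rewrite bE; lra.
exists ((b + s) / 2), (1 - n * (1 - (b + s) / 2)); split => //.
- lra.
- by nra.
- have -> : 1 - n * (1 - (b + s) / 2) = n * ((s - b) / 2) by lra.
  have -> : (n + m) * ((b + s) / 2) * (n * ((s - b) / 2)) =
          n * (n + m) * (s ^+ 2 - b ^+ 2) / 4 by field.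
  rewrite s2.
  have -> : n * (n + m) * (b ^+ 2 + 4 / (n + m) - b ^+ 2) / 4 =
          n * ((n + m) * (n + m)^-1) by lra.
  by rewrite Di mulr1.
Qed.

Lemma dirichlet_gap (R : realType) (n m mu h : R) : 0 < n -> 0 < m ->
  dirichlet_eigenpair n m mu h -> m <= (1 - mu) * ((n + 1) * (n + m)).
Proof.
move=> n0 m0 [mu1 _ hE nh].
(* After eliminating [h], the quadratic relation factors through [1 - mu]. *)
have e : (1 - mu) * ((n * mu + 1) * (n + m)) = m by move: nh; rewrite hE; lra.
rewrite -{1}e ler_wpM2l ?ler_wpM2r//; try nra.
Qed.

(* The eigenfunction pulled back to the arcs along terminus and origin. The
   explicit formula for U is (2 d^* d - I) S, so it maps the latter to the
   former. *)
Definition eigen_term (R : realType) (h : R) : amps R := Amps 1 h 1 0 h.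
Definition eigen_orig (R : realType) (h : R) : amps R := Amps 1 1 h h 0.

Lemma step_eigen_orig (R : realType) (n m h : R) : n != 0 -> n + m != 0 ->
  step n m (eigen_orig R h) = eigen_term R h.
Proof.
move=> n0 nm0; rewrite /step /eigen_term /eigen_orig /=.
by congr Amps; field.
Qed.

Lemma step_eigen_term (R : realType) (n m mu h : R) : n != 0 -> n + m != 0 ->
  dirichlet_eigenpair n m mu h ->
  step n m (eigen_term R h) =
  lincomb (2 * mu) (-1) (eigen_term R h) (eigen_orig R h).
Proof.
move=> n0 nm0 [_ _ hE nh]; rewrite /step /lincomb /eigen_term /eigen_orig /=.
have -> : 2 / n * ((n - 1) * 1 + h) = 2 * mu by rewrite hE; field.
have -> : 2 / (n + m) * (n * 1 + m * 0) = 2 * (mu * h).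
  by rewrite -[in n * 1]nh; field.
by congr Amps; ring.
Qed.

(** On the plane the step has trace [2 * mu] and determinant 1, so its powers have Chebyshev
    coefficients: for [cos th = mu], the first one is [sin (th *+ t.+1) / sin th]. *)
Definition wave (R : realType) (mu h th : R) (t : nat) : amps R :=
  let C := cos (th *+ t) in let S := sin (th *+ t) / sin th in
  lincomb (C + S * mu) (- S) (eigen_term R h) (eigen_orig R h).

Lemma iter_step_eigen_term (R : realType) (n m mu h th : R) (t : nat) :
  n != 0 -> n + m != 0 -> dirichlet_eigenpair n m mu h ->
  cos th = mu -> sin th != 0 ->
  iter t (step n m) (eigen_term R h) = wave R mu h th t.
Proof.
move=> n0 nm0 eig cth sth; elim: t => [|t IH].
  rewrite /wave /lincomb /= mulr0n cos0 sin0 !mul0r oppr0 !mul0r /eigen_term.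
  by congr Amps; ring.
rewrite iterS IH /wave step_lincomb step_eigen_orig// (step_eigen_term _ n m mu h)//.
have s2 : sin th ^+ 2 = 1 - mu ^+ 2 by rewrite sin2cos2 cth.
rewrite (mulrSr th) sinD cosD cth.
set C := cos _; set s := sin (_ *+ _).
have -> : (s * mu + C * sin th) / sin th = s / sin th * mu + C by field.
have -> : C * mu - s * sin th = C * mu - s / sin th * (1 - mu ^+ 2) by rewrite -s2; field.
by rewrite /lincomb /=; congr Amps; ring.
Qed.

(** * The success probability up to a small error *)

(* The coefficient of sin^2(t th) in the success probability. *)
Definition peak_height (R : realType) (n mu : R) : R :=
  (1 + n * mu) / ((n + 1) * (1 + mu)).

(** Young's inequality (a + e)^2 <= (1 + 1/20) a^2 + (1 + 20) e^2 with e = b + d, followed by e^2 <=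
    2 b^2 + 2 d^2. *)
Lemma sum_sq_error (R : realFieldType) (n m a1 a2 b1 b2 d1 d2 : R) :
  0 <= n -> 0 <= m ->
  n * (a1 + b1 + d1) ^+ 2 + m * (a2 + b2 + d2) ^+ 2 <=
  21 / 20 * (n * a1 ^+ 2 + m * a2 ^+ 2)
  + 42 * (n * b1 ^+ 2 + m * b2 ^+ 2) + 42 * (n * d1 ^+ 2 + m * d2 ^+ 2).
Proof.
move=> n0 m0.
have sq (a b d : R) :
    (a + b + d) ^+ 2 <= 21 / 20 * a ^+ 2 + 42 * b ^+ 2 + 42 * d ^+ 2.
  have := sqr_ge0 (a - 20 * (b + d)); have := sqr_ge0 (b - d).
  by move=> h1 h2; lra.
have := ler_wpM2l n0 (sq a1 b1 d1); have := ler_wpM2l m0 (sq a2 b2 d2).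
by move=> h1 h2; lra.
Qed.

(** The initial state is [c] times [eigen_term] plus a remainder [r0]. The sine part of the wave
    gives [M] exactly; the cosine part and the evolved remainder contribute at most [2 * n] and
    [3 * n] before scaling by [c ^+ 2], whence 210 = 42 (2 + 3). *)
Lemma into_center_scale0 (R : realType) (n m c mu h th : R) (t : nat) :
  1 <= n -> 0 < m -> dirichlet_eigenpair n m mu h ->
  cos th = mu -> sin th != 0 -> c ^+ 2 = ((n + 1) * n)^-1 ->
  let P := into_center R n m (iter t (step n m) (scale0 R c)) in
  let M := peak_height R n mu * sin (th *+ t) ^+ 2 in
  P <= 21 / 20 * M + 210 / (n + 1) /\ M <= 21 / 20 * P + 210 / (n + 1).
Proof.
move=> n1 m0 eig cth sth c2 P M.
have n0 : n != 0 by lra.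
have nm0 : n + m != 0 by lra.
pose r0 : amps R := Amps 0 (1 - h) 0 0 (- h).
pose r := iter t (step n m) r0.
pose C := cos (th *+ t); pose S := sin (th *+ t) / sin th.
have ini : scale0 R c = lincomb c c (eigen_term R h) r0.
  by rewrite /scale0 /lincomb /=; congr Amps; ring.
have [/andP[mu1 mu2] /andP[h0 h1] hE nh] := eig.
have Dh2 : (n + m) * h ^+ 2 <= 2 * n.
  have : (n + m) * mu * h * h <= n by rewrite nh; nra.
  have : 0 <= (n + m) * h * h by rewrite !mulr_ge0//; lra.
  by nra.
have rE : into_center R n m r <= 3 * n.
  apply: le_trans (into_center_le_energy _ _ _ _ n1 (ltW m0)) _.
  rewrite energy_iter_step// /energy /=.
  have : n * (1 - h) ^+ 2 <= n by rewrite ler_piMr; nra.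
  by nra.
have CE : (n + m) * h ^+ 2 * C ^+ 2 <= 2 * n.
  apply: le_trans Dh2; rewrite ler_piMr//.
    by rewrite mulr_ge0 ?sqr_ge0//; lra.
  by rewrite -(cos2Dsin2 (th *+ t)) lerDl sqr_ge0.
(* By [nh] the weighted squares collapse to n (1 - mu h) = n (1 - mu)(1 + n mu), times [S ^+ 2]; the
   factor 1 - mu cancels against [sin th ^+ 2]. *)
have ME : c ^+ 2 * (n * (S * (mu * h - 1)) ^+ 2 + m * (S * mu * h) ^+ 2) = M.
  have s2 : sin th ^+ 2 = (1 - mu) * (1 + mu) by rewrite sin2cos2 cth; ring.
  rewrite /M /peak_height c2 /S.
  transitivity ((((n + 1) * n)^-1) * (sin (th *+ t) ^+ 2 / sin th ^+ 2) *
    (n - 2 * n * (mu * h) + (mu * h) * ((n + m) * mu * h))).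
    by rewrite -expr_div_n; ring.
  rewrite nh s2 hE; field.
  by apply/and4P; split; lra.
have PE : P = c ^+ 2 * (n * (S * (mu * h - 1) + C * h + ay r) ^+ 2
                      + m * (S * mu * h + C * h + aq r) ^+ 2).
  rewrite /P ini iter_step_lincomb (iter_step_eigen_term _ n m mu h th)// -/r.
  by rewrite /into_center /wave /lincomb /= -/C -/S; ring.
have c0 : 0 <= c ^+ 2 by exact: sqr_ge0.
have cn : c ^+ 2 * n = (n + 1)^-1 by rewrite c2; field; rewrite n0 /=; lra.
move: rE; rewrite /into_center => rE.
have ng0 : 0 <= n by lra.
split.
- have := sum_sq_error _ n m (S * (mu * h - 1)) (S * mu * h)
    (C * h) (C * h) (ay r) (aq r) ng0 (ltW m0).
  move/(ler_wpM2l c0); rewrite -PE => /le_trans; apply.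
  rewrite -ME.
  have : c ^+ 2 * ((n + m) * h ^+ 2 * C ^+ 2) <= c ^+ 2 * (2 * n) by rewrite ler_wpM2l.
  have := ler_wpM2l c0 rE.
  rewrite -cn; lra.
(* The same inequality with the roles exchanged: the sine part is the full amplitude minus the two
   errors. *)
- have := sum_sq_error _ n m (S * (mu * h - 1) + C * h + ay r)
    (S * mu * h + C * h + aq r) (- (C * h)) (- (C * h)) (- ay r) (- aq r) ng0 (ltW m0).
  move/(ler_wpM2l c0); rewrite PE.
  have -> : S * (mu * h - 1) + C * h + ay r - C * h - ay r = S * (mu * h - 1) by ring.
  have -> : S * mu * h + C * h + aq r - C * h - aq r = S * mu * h by ring.
  rewrite ME => /le_trans; apply.
  have : c ^+ 2 * ((n + m) * h ^+ 2 * C ^+ 2) <= c ^+ 2 * (2 * n) by rewrite ler_wpM2l.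
  have := ler_wpM2l c0 rE.
  rewrite -cn; lra.
Qed.

(** * Trigonometric estimates and first peaks *)

Lemma sin_le_id (R : realType) (x : R) : 0 <= x -> sin x <= x.
Proof.
move=> x0.
have [|c _] := @MVT_segment R (@sin R) (@cos R) 0 x x0 (fun y _ => is_derive_sin y).
  by apply: continuous_subspaceT; exact: continuous_sin.
rewrite sin0 !subr0 => ->; rewrite ler_piMl//; exact: cos_le1.
Qed.

Lemma ler_cos (R : realType) (x y : R) :
  0 <= x -> x <= y -> y <= pi -> cos y <= cos x.
Proof.
move=> x0 xy ypi; rewrite leNgt ltr_cos ?in_itv /= -?leNgt//; apply/andP; lra.
Qed.

Lemma sin_sq_window (R : realType) (a x : R) :
  0 <= a <= pi -> cos a = - (1 / 2) -> a <= x <= 2 * a -> sin x ^+ 2 <= 3 / 4.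
Proof.
move=> /andP[a0 api] ca /andP[ax xa].
suff cx : cos x <= - (1 / 2) by rewrite sin2cos2; nra.
have pi0 := pi_gt0 R.
have c2a : cos (2 * a) = - (1 / 2) by rewrite mulr_natl cos_mulr2n ca; lra.
have [xpi|pix] := leP x pi; first by rewrite -ca ler_cos.
(* Beyond pi, reflecting about pi returns to the interval where cosine decreases. *)
have cosC (y : R) : cos (pi *+ 2 - y) = cos y by rewrite cosB cos2pi sin2pi; ring.
have pia : pi <= a *+ 2 by rewrite mulr2n; lra.
by rewrite -(cosC x) -c2a -(cosC (2 * a)) ler_cos//; lra.
Qed.

(** A maximizer over [0, L] cannot lie in the second half, where [f] stays below [f t0]; hence its
    doubled window fits inside [0, L]. *)
Lemma window_argmax (R : realType) (f : nat -> R) (t0 L : nat) :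
  (t0 <= L)%N -> f 0%N < f t0 ->
  (forall t, (t <= L)%N -> (L < 2 * t)%N -> f t < f t0) ->
  exists t, [/\ (2 * t <= L)%N, f 0%N < f t &
                forall s, (s <= 2 * t)%N -> f s <= f t].
Proof.
move=> t0L f0 late.
have [t _ tmax] := @Order.TotalTheory.arg_maxP _ R 'I_L.+1 (inord t0) xpredT
  (fun i => f i) isT.
have le_t s : (s <= L)%N -> f s <= f t.
  by move=> sL; have := tmax (inord s) isT; rewrite inordK.
have tL : (2 * t <= L)%N.
  rewrite leqNgt; apply/negP => Lt.
  by have := late t (ltn_ord t : (t <= L)%N) Lt; rewrite ltNge le_t.
exists t; split=> //; first exact: lt_le_trans (le_t _ t0L).
by move=> s st; apply: le_t; exact: leq_trans st tL.
Qed.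

Lemma is_topt_le_peak (R : realType) (N m t : nat) : is_peak R N m t ->
  exists2 t', is_topt R N m t' & (t' <= t)%N.
Proof.
move=> pt.
have ex : exists s, `[< is_peak R N m s >] by exists t; apply/asboolP.
case: (ex_minnP ex) => t' /asboolP pt' min_t'; exists t'.
  by split => // s st' /asboolP /min_t'; rewrite leqNgt st'.
by apply: min_t'; apply/asboolP.
Qed.

Lemma into_center_init (R : realType) (n m c : R) :
  into_center R n m (scale0 R c) = n * c ^+ 2.
Proof. by rewrite /into_center /=; ring. Qed.

Lemma dirichlet_estimates (R : realType) (n m mu h : R) : 100 * 100 <= n ->
  dirichlet_eigenpair n m mu h ->
  99 / 100 <= mu /\ 49 / 100 <= peak_height R n mu.
Proof.
move=> n_big [/andP[mu1 mu2] /andP[h0 h1] hE _]; rewrite hE in h0.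
(* [0 <= h] means 1 - mu <= 1/n. *)
have mu_n : 99 / 100 <= mu by nra.
split=> //; rewrite /peak_height ler_pdivlMr; last by rewrite mulr_gt0//; lra.
by nra.
Qed.

(* The window is chosen so that t >= (L+1)/2 forces th * t into
   [2 pi / 3, 4 pi / 3]. *)
Lemma sin_window (R : realType) (th : R) : 0 < th < pi ->
  exists t0 L : nat, [/\ (t0 <= L)%N, L%:R * th <= 8,
    cos th <= sin (th *+ t0) &
    forall t, (t <= L)%N -> (L < 2 * t)%N -> sin (th *+ t) ^+ 2 <= 3 / 4].
Proof.
move=> /andP[th0 thpi]; pose a : R := acos (- (1 / 2)).
have pi0 := pi_gt0 R.
have ca : cos a = - (1 / 2) by rewrite acosK// in_itv /=; apply/andP; lra.
have a0 : 0 <= a by apply: acos_ge0; apply/andP; lra.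
have api : a <= pi by apply: acos_lepi; apply/andP; lra.
have pia : pi / 2 <= a.
  rewrite leNgt; apply/negP => ap.
  by have := ler_cos R a (pi / 2) a0 (ltW ap) ltac:(lra); rewrite cos_pihalf ca; lra.
pose L := Num.truncn (2 * a / th); pose t0 := Num.truncn (pi / 2 / th).
have /andP[L1 L2] : L%:R <= 2 * a / th < L.+1%:R.
  by apply: truncn_itv; rewrite divr_ge0//; lra.
have /andP[T1 T2] : t0%:R <= pi / 2 / th < t0.+1%:R.
  by apply: truncn_itv; rewrite divr_ge0//; lra.
have t0L : (t0 <= L)%N by apply: le_truncn; rewrite ler_pM2r ?invr_gt0//; lra.
rewrite ler_pdivlMr// in L1; rewrite ltr_pdivrMr// in L2.
rewrite ler_pdivlMr// in T1; rewrite ltr_pdivrMr// in T2.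
exists t0, L; split=> //.
- by have := pihalf_lt2 R; lra.
- rewrite -mulr_natr -[_ * _]opprK sinN.
  (* By the choice of the floor, [th * t0] falls short of pi/2 by less than [th], so its sine is at
     least [cos th]. *)
  have -> : - (th * t0%:R) = (pi / 2 - th * t0%:R) - pi / 2 by ring.
  rewrite sinBpihalf opprK ler_cos//; last exact: ltW.
    by rewrite subr_ge0 mulrC.
  by move: T2; rewrite -natr1; lra.
- move=> t tL Lt; apply: (sin_sq_window R a) => //; first by apply/andP.
  have tLR : t%:R <= L%:R :> R by rewrite ler_nat.
  have LtR : L.+1%:R <= 2 * t%:R :> R by rewrite -natrM ler_nat.
  have h1 := ler_wpM2r (ltW th0) tLR; have h2 := ler_wpM2r (ltW th0) LtR.
  by rewrite -mulr_natr; apply/andP; split; lra.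
Qed.

(** * Existence of an early peak *)

Lemma peak_contrast (R : realFieldType) (K e s p : R) :
  49 / 100 <= K -> e <= 1 / 100 / 100 -> 99 / 100 <= s ->
  K * s ^+ 2 <= 21 / 20 * p + 210 * e ->
  21 / 20 * (K * (3 / 4)) + 210 * e < p.
Proof.
move=> K1 e1 s1 Kp.
(* At the extreme values K = 0.49 and e = 0.0001 the left side is about 0.407 and [p] is at least
   about 0.437; the margin grows with [K]. *)
have s2 : (99 / 100) ^+ 2 <= s ^+ 2 by rewrite lerXn2r ?nnegrE//; lra.
have := ler_wpM2l (_ : 0 <= K) s2; move/(_ ltac:(lra)); lra.
Qed.

(** The peak satisfies t th <= 4, hence t^2 (1 - mu) <= t^2 sin^2 th <= 16, and the spectral gap
    bounds 1 - mu from below. *)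
Lemma early_peak (R : realType) (n m : nat) : 100 * 100 <= n%:R :> R ->
  (0 < m)%N ->
  exists2 t, is_peak R n.+1 m t &
    t%:R ^+ 2 * m%:R <= 16 * ((n%:R + 1) * (n%:R + m%:R)) :> R.
Proof.
move=> n_big m_gt0.
have mR : 0 < m%:R :> R by rewrite ltr0n.
have n2 : 2 <= n%:R :> R by apply: le_trans n_big; lra.
have [mu [h eig]] := dirichlet_eigenpair_exists R n%:R m%:R n2 mR.
have gap := dirichlet_gap R n%:R m%:R mu h ltac:(lra) mR eig.
have [mu_big K_big] := dirichlet_estimates R n%:R m%:R mu h n_big eig.
have N1 : (n%:R + 1)^-1 <= 1 / 100 / 100 :> R.
  have -> : 1 / 100 / 100 = (100 * 100)^-1 :> R by rewrite invfM; ring.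
  by rewrite lef_pV2 ?posrE; lra.
clear n_big.
have [/andP[_ mu1] _ _ _] := eig.
pose th : R := acos mu.
have cth : cos th = mu by rewrite acosK// in_itv /=; apply/andP; lra.
have th0 : 0 < th by apply: acos_gt0; apply/andP; lra.
have thpi : th < pi by apply: acos_ltpi; apply/andP; lra.
have sth0 : 0 < sin th by apply: sin_gt0_pi; apply/andP.
have [t0 [L [t0L Lth s_t0 s_late]]] := sin_window R th ltac:(by apply/andP).
pose c : R := (Num.sqrt ((n.+1 * n)%:R))^-1.
have c2 : c ^+ 2 = ((n%:R + 1) * n%:R)^-1.
  by rewrite exprVn sqr_sqrtr ?ler0n// natrM -natr1.
pose K := peak_height R n%:R mu.
have bounds t :
    psucc R n.+1 m t <= 21 / 20 * (K * sin (th *+ t) ^+ 2) + 210 / (n%:R + 1) /\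
    K * sin (th *+ t) ^+ 2 <= 21 / 20 * psucc R n.+1 m t + 210 / (n%:R + 1).
  rewrite psuccE; apply: (into_center_scale0 R _ _ _ mu h th) => //; first lra.
  by rewrite gt_eqF.
have P_t0 : 21 / 20 * (K * (3 / 4)) + 210 / (n%:R + 1) < psucc R n.+1 m t0.
  apply: peak_contrast (bounds t0).2 => //.
  by apply: le_trans s_t0; rewrite cth.
have P_0 : psucc R n.+1 m 0 < psucc R n.+1 m t0.
  have -> : psucc R n.+1 m 0 = (n%:R + 1)^-1.
    rewrite psuccE into_center_init -/c c2; field.
    by apply/andP; split; lra.
  apply: lt_trans P_t0; move: K_big; rewrite -/K => K_big.
  have : 0 < (n%:R + 1)^-1 :> R by rewrite invr_gt0; lra.
  by clear -K_big; lra.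
have [t tL Lt|t [tL Pt tmax]] := window_argmax R (psucc R n.+1 m) t0 L t0L P_0.
  apply: le_lt_trans P_t0; apply: le_trans (bounds t).1 _.
  rewrite lerD2r ler_wpM2l; first by [].
    by clear; lra.
  by rewrite ler_wpM2l ?s_late// (le_trans _ K_big)//; clear; lra.
exists t; first by split.
have t_ge0 : 0 <= t%:R :> R by rewrite ler0n.
have tth : t%:R * th <= 4.
  have tLR : 2 * t%:R <= L%:R :> R by rewrite -natrM ler_nat.
  have := ler_wpM2r (ltW th0) tLR; clear -Lth; lra.
have ts : t%:R * sin th <= 4.
  by apply: le_trans tth; rewrite ler_wpM2l ?sin_le_id// ltW.
have t2 : t%:R ^+ 2 * (1 - mu) <= 16.
  have s2 : sin th ^+ 2 = 1 - mu ^+ 2 by rewrite sin2cos2 cth.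
  have : (t%:R * sin th) ^+ 2 <= 4 ^+ 2.
    by rewrite lerXn2r ?nnegrE ?mulr_ge0 ?(ltW sth0).
  rewrite exprMn s2 => h2; apply: le_trans (_ : 4 ^+ 2 <= 16); last by clear; lra.
  apply: le_trans h2.
  by rewrite ler_wpM2l ?sqr_ge0//; clear -mu_big mu1; nra.
have h1 := ler_wpM2l (sqr_ge0 (t%:R : R)) gap.
have D0 : 0 <= (n%:R + 1) * (n%:R + m%:R) :> R by rewrite mulr_ge0//; lra.
have h2 := ler_wpM2r D0 t2.
by move: h1; rewrite [X in _ <= X]mulrA => h1; exact: le_trans h1 h2.
Qed.

(** * Comparison with the claimed rates *)

Lemma peak_time_le (R : realType) (alpha t : R) (N : nat) :
  0 <= alpha -> 1 <= N%:R :> R -> 0 <= t ->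
  t ^+ 2 * (mstar N alpha)%:R <= 16 * (N%:R * (N%:R + (mstar N alpha)%:R)) ->
  t <= 8 * topt_bound alpha N.
Proof.
move=> alpha0 N1 t0.
have N0 : 0 <= N%:R :> R by lra.
have x1 : 1 <= powR N%:R alpha by have := ler_powR N1 alpha0; rewrite powRr0.
have x0 : 0 <= powR N%:R alpha by lra.
have /andP[m1 m2] := truncn_itv x0; rewrite -/(mstar N alpha) in m1 m2.
have m_gt0 : 1 <= (mstar N alpha)%:R :> R by rewrite ler1n truncn_gt0.
rewrite /topt_bound; case: ifPn => alpha1.
- have xN : powR N%:R alpha <= N%:R by rewrite ler1_powR.
  set x := powR N%:R alpha in x1 x0 m1 m2 xN *.
  set B := powR _ _.
  have B0 : 0 <= B by exact: powR_ge0.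
  (* As x < m + 1 <= 2m and m <= N, the hypothesis gives t^2 x <= 64 N^2 = (8 B)^2 x. *)
  have BB : B ^+ 2 * x = N%:R ^+ 2.
    rewrite -powR_mulrn// /B -powRrM divfK ?pnatr_eq0// /x -powRD.
      by rewrite subrK powR_mulrn.
    by apply/implyP => _; rewrite gt_eqF//; lra.
  rewrite -natr1 in m2; move: (mstar N alpha)%:R m1 m2 m_gt0 => m m1 m2 m3 h.
  have x_gt0 : 0 < x by lra.
  suff t2 : t ^+ 2 <= (8 * B) ^+ 2 by rewrite -ler_sqr ?nnegrE ?mulr_ge0.
  rewrite -(ler_pM2r x_gt0) exprMn -[X in _ <= X]mulrA BB.
  have : t ^+ 2 * x <= t ^+ 2 * (2 * m) by rewrite ler_wpM2l ?sqr_ge0//; lra.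
  have : N%:R * (N%:R + m) <= N%:R * (2 * N%:R) by rewrite ler_wpM2l//; lra.
  lra.
- have xN : N%:R <= powR N%:R alpha by rewrite le1r_powR//; lra.
  (* Now N + m <= 2m, so [m] cancels and t^2 <= 32 N. *)
  have mN : N%:R <= (mstar N alpha)%:R :> R by rewrite ler_nat truncn_ge_nat.
  move: (mstar N alpha)%:R mN m_gt0 => m mN m0 h.
  have s0 := sqrtr_ge0 (N%:R : R).
  suff t2 : t ^+ 2 <= (8 * Num.sqrt N%:R) ^+ 2 by rewrite -ler_sqr ?nnegrE ?mulr_ge0.
  have m_gt0' : 0 < m by lra.
  rewrite exprMn sqr_sqrtr// -(ler_pM2r m_gt0'); apply: le_trans h _.
  have : N%:R * (N%:R + m) <= N%:R * (2 * m) by rewrite ler_wpM2l//; lra.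
  have := mulr_ge0 N0 (ltW m_gt0'); lra.
Qed.

Theorem theorem2 (R : realType) (alpha : R) :
  0 <= alpha ->
  exists C : R, 0 < C /\
  exists N0 : nat, forall N : nat, (2 <= N)%N -> (N0 <= N)%N ->
    exists t : nat, is_topt R N (mstar N alpha) t /\
                    t%:R <= C * topt_bound alpha N.
Proof.
move=> alpha0; exists 8; split; first by lra.
(* The successor makes n = N - 1 reach the threshold of [early_peak]. *)
exists (100 * 100).+1 => -[//|n] _ n_big.
have nR : 100 * 100 <= n%:R :> R by rewrite -natrM ler_nat.
have N1 : 1 <= n.+1%:R :> R by rewrite ler1n.
have m_gt0 : (0 < mstar n.+1 alpha)%N.
  by rewrite truncn_gt0; have := ler_powR N1 alpha0; rewrite powRr0.
have [t pt t_le] := early_peak R n (mstar n.+1 alpha) nR m_gt0.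
have [t' topt t't] := is_topt_le_peak R _ _ _ pt.
exists t'; split => //.
apply: le_trans (_ : t%:R <= _); first by rewrite ler_nat.
apply: peak_time_le => //.
apply: le_trans t_le _; rewrite -[n.+1]addn1 natrD ler_wpM2l//.
by rewrite ler_wpM2l//; lra.
Qed.
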